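(* Let $n\ge 2$ be an integer, let $p=(p_0,\ldots,p_n)$ be a probability vector ($p_i\ge 0$, $\sum_{i=0}^n p_i=1$), and let $u=(u_0,\ldots,u_n)$, where $$u_k=\binom{n}{k}^{-1}\sum_{j=k}^n\binom{j}{k}p_j,\qquad k=0,1,\ldots,n.$$ If $n=2m$, set $$A(\varepsilon)=\big(u_{i+j}\big)_{i,j=0}^m,\qquad B(\varepsilon)=\big(u_{i+j+1}-u_{i+j+2}-\varepsilon(1-\varepsilon)u_{i+j}\big)_{i,j=0}^{m-1},$$ and if $n=2m+1$, set $$A(\varepsilon)=\big(u_{i+j+1}-\varepsilon u_{i+j}\big)_{i,j=0}^m,\qquad B(\varepsilon)=\big((1-\varepsilon)u_{i+j}-u_{i+j+1}\big)_{i,j=0}^m.$$ Then the following are equivalent. (i) $A(\varepsilon)\succeq 0$ and $B(\varepsilon)\succeq 0$ for some $\varepsilon$ with $0<\varepsilon<1/2$. (ii) $p\in\mathrm{Conv}[B_0]$, where $B_0=\left\{\left(\binom{n}{j}q^j(1-q)^{n-j}\right)_{j=0}^n:\ 0<q<1\right\}\subseteq\mathbb{R}^{n+1}$ is the open binomial probability curve (without its endpoints). (iii) There exists a random variable $V$ with $\mathbb{P}(0<V<1)=1$ such that $$p_j=\mathbb{E}\left\{\binom{n}{j}V^j(1-V)^{n-j}\right\},\qquad j=0,1,\ldots,n.$$ (iv) $u\in\mathrm{Conv}[M_0]$, where $M_0=\{(1,t,t^2,\ldots,t^n):\ 0<t<1\}\subseteq\mathbb{R}^{n+1}$ is the open moment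 curve (without its endpoints). (v) There exists a random variable $V$ with $\mathbb{P}(0<V<1)=1$ such that $u_k=\mathbb{E}V^k$ for $k=0,1,\ldots,n$.
   Context: $\mathrm{Conv}[X]$ denotes the convex hull of $X\subseteq\mathbb{R}^{n+1}$ (the set of all finite convex combinations of points of $X$). For a real symmetric matrix $A$, $A\succeq 0$ means that $A$ is positive semi-definite. *)

(* Defs.v *)
From mathcomp Require Export all_boot all_order all_algebra.
From mathcomp Require Export all_classical all_reals all_analysis.

Set Implicit Arguments.
Unset Strict Implicit.
Unset Printing Implicit Defensive.

Import Order.TTheory GRing.Theory Num.Theory.
Local Open Scope classical_set_scope.
Local Open Scope ring_scope.

Definition convex_hull (R : numDomainType) (E : lmodType R) (X : set E) :
    set E :=
  [set x | exists (k : nat) (w : 'I_k -> R) (v : 'I_k -> E),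
     [/\ forall i, 0 <= w i, \sum_(i < k) w i = 1, forall i, X (v i)
       & x = \sum_(i < k) w i *: v i]].

Definition psd (R : numDomainType) (n : nat) (A : 'M[R]_n) : Prop :=
  A^T = A /\ forall x : 'rV[R]_n, 0 <= (x *m A *m x^T) 0 0.

(* E[C(X, k)] / C(n, k) for X of law p; only k <= n is meaningful. *)
Definition umoment (R : realType) (n : nat) (p : 'rV[R]_n.+1) (k : nat) : R :=
  'C(n, k)%:R^-1 * \sum_(j < n.+1 | (k <= j)%N) 'C(j, k)%:R * p 0 j.

(* The sizes depend on the parity of n = 2m or n = 2m+1: n./2 = m in both
   cases, while uphalf n = m for even n and m+1 for odd n. All the indices of
   u occurring below are at most n. *)
Definition matA (R : realType) (n : nat) (u : nat -> R) (eps : R) :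
    'M[R]_(n./2.+1) :=
  if odd n then \matrix_(i, j) (u (i + j).+1 - eps * u (i + j)%N)
  else \matrix_(i, j) u (i + j)%N.

Definition matB (R : realType) (n : nat) (u : nat -> R) (eps : R) :
    'M[R]_(uphalf n) :=
  if odd n then \matrix_(i, j) ((1 - eps) * u (i + j)%N - u (i + j).+1)
  else \matrix_(i, j)
    (u (i + j).+1 - u (i + j).+2 - eps * (1 - eps) * u (i + j)%N).

(* binomial_pmf n q j is 'C(n, j) q^j (1 - q)^(n - j). *)
Definition open_binomial_curve (R : realType) (n : nat) : set 'rV[R]_n.+1 :=
  [set (\row_(j < n.+1) binomial_pmf n q j) | q in [set q : R | 0 < q < 1]].

Definition open_moment_curve (R : realType) (n : nat) : set 'rV[R]_n.+1 :=
  [set (\row_(k < n.+1) t ^+ k) | t in [set t : R | 0 < t < 1]].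

Arguments open_binomial_curve : clear implicits.
Arguments open_moment_curve : clear implicits.

(* Main.v *)
Require Import Defs.
From HB Require Import structures.
From mathcomp Require Import finmap zify ring lra.
From mathcomp Require Import measurable_realfun lebesgue_integral.

(* Identify u with the functional L on polynomials sending X^k to u_k. If u is
   not in the convex hull of the moment curve over a set S, a supporting
   hyperplane is a nonzero q >= 0 on S with L q <= 0. Then L is carried by the
   finitely many roots of q in S, and Lagrange interpolation at these roots
   exhibits u as a convex combination after all. When L is an expectation over
   S = (0, 1), this is because q(V) = 0 almost surely. When L satisfies the
   matrix inequalities, it is nonnegative on polynomials that are nonnegative on
   S = [eps, 1 - eps] by Lukacs' theorem; if f >= 0 at the roots of q then
   f + eta + C q >= 0 on S for large C, hence L f >= - eta for every eta > 0.
   Finally p -> u is linear and injective and maps the binomial curve onto the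
   moment curve. *)

Set Implicit Arguments.
Unset Strict Implicit.
Unset Printing Implicit Defensive.

Import Order.TTheory GRing.Theory Num.Theory.
Import numFieldNormedType.Exports.
Local Open Scope classical_set_scope.
Local Open Scope ring_scope.

(** * Weak separation in finite dimension *)

Section Separation.
Variable R : realType.

Local Notation dot u v := ((u *m v^T) 0 0).

Lemma dotC d (u v : 'rV[R]_d) : dot u v = dot v u.
Proof. by rewrite !mxE; apply: eq_bigr => j _; rewrite !mxE mulrC. Qed.

Lemma dot_ge0 d (u : 'rV[R]_d) : 0 <= dot u u.
Proof. by rewrite mxE sumr_ge0 // => j _; rewrite mxE -expr2 sqr_ge0. Qed.

Lemma dot_eq0 d (u : 'rV[R]_d) : dot u u = 0 -> u = 0.
Proof.
rewrite mxE => /eqP; rewrite psumr_eq0; last first.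
  by move=> j _; rewrite mxE -expr2 sqr_ge0.
move=> /allP u0; apply/rowP => j; have := u0 j; rewrite mem_index_enum mxE.
by move=> /(_ isT)/eqP/eqP; rewrite mulf_eq0 orbb mxE => /eqP.
Qed.

Lemma dot_comb d (a b : R) (u v : 'rV[R]_d) :
  dot (a *: u + b *: v) (a *: u + b *: v) =
  a ^+ 2 * dot u u + 2 * a * b * dot u v + b ^+ 2 * dot v v.
Proof.
have tr (z : 'rV[R]_d) : (z *m (a *: u + b *: v)^T) 0 0 = a * dot z u + b * dot z v.
  rewrite linearD !linearZ /= mulmxDr -!scalemxAr.
  by rewrite mxE [X in X + _]mxE [X in _ + X]mxE.
rewrite tr !(dotC (_ + _)) !tr (dotC v u); ring.
Qed.

Lemma continuous_sum (T : topologicalType) (I : finType) (f : I -> T -> R) :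
  (forall i, continuous (f i)) -> continuous (fun x => \sum_i f i x).
Proof.
move=> fc x; rewrite /continuous_at.
have -> : (fun x => \sum_i f i x) = \sum_i f i.
  by apply/funext => y; rewrite fct_sumE.
elim/big_rec2 : _ => [|i y g _ cy]; first exact: cvg_cst.
by apply: cvgD => //; exact: fc.
Qed.

Lemma continuous_mul (T : topologicalType) (f g : T -> R) :
  continuous f -> continuous g -> continuous (fun x => f x * g x).
Proof. by move=> fc gc x; apply: cvgM; [exact: fc | exact: gc]. Qed.

Lemma continuous_coord d (j : 'I_d) : continuous (fun u : 'rV[R]_d => u 0 j).
Proof. exact: coord_continuous. Qed.

Lemma continuous_dotl d (v : 'rV[R]_d) : continuous (fun u : 'rV[R]_d => dot u v).
Proof.
have -> : (fun u : 'rV[R]_d => dot u v) = (fun u => \sum_j u 0 j * v 0 j).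
  by apply/funext => u; rewrite mxE; apply: eq_bigr => j _; rewrite mxE.
apply: continuous_sum => j.
by apply: continuous_mul; [exact: continuous_coord | exact: cst_continuous].
Qed.

Lemma continuous_dot d : continuous (fun u : 'rV[R]_d => dot u u).
Proof.
have -> : (fun u : 'rV[R]_d => dot u u) = (fun u => \sum_j u 0 j * u 0 j).
  by apply/funext => u; rewrite mxE; apply: eq_bigr => j _; rewrite mxE.
apply: continuous_sum => j.
by apply: continuous_mul; exact: continuous_coord.
Qed.

Lemma compact_rV_le1 d (A : set 'rV[R]_d) :
  (forall u, A u -> forall j, `|u 0 j| <= 1) -> closed A -> compact A.
Proof.
move=> A1; apply: bounded_closed_compact; exists 1; split => // M M1 u /A1 u1.
apply: le_trans (ltW M1); rewrite [leLHS]/Num.Def.normr /= mx_normrE.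
by apply/bigmax_leP; split => // -[i j] _ /=; rewrite ord1.
Qed.

Lemma compact_unit_sphere d : compact [set c : 'rV[R]_d | dot c c = 1].
Proof.
apply: compact_rV_le1 => [u /= u1 j|].
  rewrite -(@expr_le1 _ 2) // -normrX ger0_norm ?sqr_ge0 // -u1 mxE (bigD1 j) //=.
  rewrite mxE -expr2 lerDl sumr_ge0 // => i _; rewrite mxE -expr2.
  exact: sqr_ge0.
rewrite (_ : [set c | _] = (fun u : 'rV[R]_d => dot u u) @^-1` [set 1]) //.
by apply: closed_comp => [u _|]; [exact: continuous_dot | exact: closed_eq].
Qed.

Lemma compact_simplex k :
  compact [set w : 'rV[R]_k | (forall i, 0 <= w 0 i) /\ \sum_i w 0 i = 1].
Proof.
apply: compact_rV_le1 => [w [w0 w1] j|].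
  by rewrite ger0_norm // -w1 (bigD1 j) //= lerDl sumr_ge0.
rewrite (_ : [set w | _] = \bigcap_i [set w : 'rV[R]_k | 0 <= w 0 i] `&`
  (fun w : 'rV[R]_k => \sum_i w 0 i) @^-1` [set 1]); last first.
  by apply/seteqP; split => w [w0 w1]; split => // i *; exact: w0.
apply: closedI; [apply: closed_bigI => i _ |].
  apply: (@closed_comp _ _ (fun w : 'rV[R]_k => w 0 i) [set x | 0 <= x]).
    by move=> w _; exact: continuous_coord.
  exact: closed_ge.
apply: closed_comp => [u _|]; last exact: closed_eq.
by apply: continuous_sum => i; exact: continuous_coord.
Qed.

(* The point of least norm of the convex hull is the separating normal. *)
Lemma finite_separation d k (v : 'I_k -> 'rV[R]_d.+1) :
  (forall w : 'I_k -> R, (forall i, 0 <= w i) -> \sum_i w i = 1 ->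
     \sum_i w i *: v i <> 0) ->
  exists2 c : 'rV[R]_d.+1, dot c c = 1 & forall i, 0 <= dot c (v i).
Proof.
move=> hull0.
have [k0|k0] := posnP k.
  exists (delta_mx 0 0) => [|i].
    by rewrite trmx_delta mul_delta_mx mxE.
  by have := ltn_ord i; rewrite {2}k0.
pose y (w : 'rV[R]_k) := w *m \matrix_i v i.
have yE w : y w = \sum_i w 0 i *: v i.
  by rewrite /y mulmx_sum_row; apply: eq_bigr => i _; rewrite rowK.
pose W := [set w : 'rV[R]_k | (forall i, 0 <= w 0 i) /\ \sum_i w 0 i = 1].
have deltaW i : W (delta_mx 0 i).
  split=> [j|]; first by rewrite mxE ler0n.
  rewrite (bigD1 i) //= mxE !eqxx big1 ?addr0 // => j ji.
  by rewrite mxE (negbTE ji).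
have W0 : W !=set0 by exists (delta_mx 0 (Ordinal k0)); exact: deltaW.
have cy : continuous (fun w => dot (y w) (y w)).
  rewrite (_ : (fun w => _) = (fun w : 'rV[R]_k =>
    \sum_j (\sum_i w 0 i * v i 0 j) * (\sum_i w 0 i * v i 0 j))).
    apply: continuous_sum => j; apply: continuous_mul; apply: continuous_sum => i;
    by apply: continuous_mul; [exact: continuous_coord | exact: cst_continuous].
  apply/funext => w; rewrite yE mxE; apply: eq_bigr => j _.
  rewrite [(_^T) j 0]mxE summxE.
  by under [X in X * X]eq_bigr do rewrite mxE.
have [w /set_mem [w0 w1] minw] :=
  EVT_min_rV W0 (@compact_simplex k) (continuous_subspaceT cy).
have yy0 : 0 < dot (y w) (y w).
  rewrite lt_neqAle dot_ge0 andbT eq_sym; apply/eqP => /dot_eq0.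
  by rewrite yE; exact: hull0.
have yv i : 0 <= dot (y w) (v i).
  rewrite leNgt; apply/negP => lt0.
  set a := dot (y w) (y w) in yy0 minw *; set b := dot (y w) (v i) in lt0.
  pose e := dot (v i) (v i).
  have e0 : 0 <= e := dot_ge0 _.
  (* Moving a fraction [s] of the way from [y w] to [v i] changes the squared norm by
     [s * (- a + (2 - s) * b)] for this [s]. That is negative when [a > 0 > b], against the
     minimality of [w]. *)
  pose s := a / (a - b + e).
  have den : 0 < a - b + e by lra.
  have s0 : 0 < s by rewrite divr_gt0.
  have s1 : s <= 1 by rewrite ler_pdivrMr //; lra.
  have Ws : W ((1 - s) *: w + s *: delta_mx 0 i).
    have [d0 d1] := deltaW i; split=> [j|].
      by rewrite !mxE addr_ge0 // mulr_ge0 //; lra.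
    rewrite (eq_bigr (fun j => (1 - s) * w 0 j + s * (delta_mx 0 i : 'rV_k) 0 j)).
      by rewrite big_split /= -!mulr_sumr w1 d1; lra.
    by move=> j _; rewrite !mxE.
  have := minw _ (mem_set Ws).
  have -> : y ((1 - s) *: w + s *: delta_mx 0 i) = (1 - s) *: y w + s *: v i.
    by rewrite /y mulmxDl -!scalemxAl -rowE rowK.
  rewrite dot_comb -/a -/b -/e.
  have sE : s * (a - b + e) = a by rewrite /s mulfVK ?gt_eqF.
  nra.
exists ((Num.sqrt (dot (y w) (y w)))^-1 *: y w).
  rewrite linearZ /= -scalemxAl -scalemxAr scalerA mxE -invfM -expr2 sqr_sqrtr.
    by rewrite mulVf ?gt_eqF.
  exact: ltW.
by move=> i; rewrite -scalemxAl mxE mulr_ge0 // invr_ge0 sqrtr_ge0.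
Qed.

(** Each [x] in [X] cuts a closed set of admissible normals out of the compact unit sphere. By the
    finite case finitely many of these sets always meet, hence they all do. Unit length keeps the
    normal away from 0, and [X] may be any set, closed or not. *)
Lemma weak_separation d (X : set 'rV[R]_d.+1) :
  ~ convex_hull X 0 ->
  exists2 c : 'rV[R]_d.+1, c != 0 & forall x, X x -> 0 <= dot c x.
Proof.
move=> X0; have := @compact_unit_sphere d.+1; rewrite compact_In0.
move=> /(_ _ X (fun x => [set c | dot c c = 1] `&` [set c | 0 <= dot c x])).
case.
- exists (fun x => [set c | 0 <= dot c x]) => // x _.
  apply: (@closed_comp _ _ (fun c : 'rV[R]_d.+1 => dot c x) [set t | 0 <= t]).
    by move=> c _; exact: continuous_dotl.
  exact: closed_ge.
- move=> D DX.
  pose v (i : 'I_#|`D|) := nth 0 D i.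
  have vD i : v i \in D by rewrite mem_nth.
  have [|c c1 cv] := @finite_separation d _ v.
    move=> w w0 w1 wv; apply: X0; exists #|`D|, w, v; split => // i.
    by apply/set_mem/DX; exact: vD.
  exists c => x /= xD; split => //.
  have xi : (index x D < #|`D|)%N by rewrite index_mem.
  by have := cv (Ordinal xi); rewrite /v nth_index.
(* Over an empty [X] the intersection is the whole space and says nothing about [c], so a unit
   vector is supplied by hand. *)
- move=> c cX; have [->|/set0P [x0 Xx0]] := eqVneq X set0.
    exists (delta_mx 0 0) => //; apply/eqP => /matrixP /(_ 0 0) /eqP.
    by rewrite !mxE oner_eq0.
  exists c => [|x /cX [] //]; have [/= c1 _] := cX _ Xx0.
  by apply: contra_eq_neq c1 => ->; rewrite mul0mx mxE eq_sym oner_eq0.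
Qed.
End Separation.

(** * Representation of positive functionals *)

Section LinearFunctionals.
Variables (R : realType) (L : {poly R} -> R).
Hypothesis Llin : linear_for *%R L.

Lemma functional0 : L 0 = 0.
Proof. by have := Llin (-1) 0 0; rewrite scaler0 addr0 mulN1r addNr. Qed.

Lemma functionalZ a f : L (a *: f) = a * L f.
Proof. by have := Llin a f 0; rewrite functional0 !addr0. Qed.

Lemma functionalD f g : L (f + g) = L f + L g.
Proof. by have := Llin 1 f g; rewrite scale1r mul1r. Qed.

Lemma functionalN f : L (- f) = - L f.
Proof. by rewrite -scaleN1r functionalZ mulN1r. Qed.

Lemma functionalB f g : L (f - g) = L f - L g.
Proof. by rewrite functionalD functionalN. Qed.

Lemma functional_sum (I : Type) (r : seq I) (P : pred I) (F : I -> {poly R}) :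
  L (\sum_(i <- r | P i) F i) = \sum_(i <- r | P i) L (F i).
Proof. exact: (big_morph L functionalD functional0). Qed.

Lemma functionalC a : L a%:P = a * L 1.
Proof. by rewrite -[a%:P]mulr1 mul_polyC functionalZ. Qed.

End LinearFunctionals.

Section Representation.
Variable R : realType.

Lemma roots_in_set (S : set R) (q : {poly R}) : q != 0 ->
  exists2 rs : seq R, uniq rs & forall t, (t \in rs) <-> (S t /\ root q t).
Proof.
move=> q0; have [rs qrs] : exists rs : seq R, forall t, root q t -> t \in rs.
  have [m] := ubnP (size q); elim: m q q0 => // m IH q q0 qm.
  have [[t qt]|noroot] := pselect (exists t, root q t); last first.
    by exists [::] => t qt; case: noroot; exists t.
  have /factor_theorem [g qE] := qt.
  have g0 : g != 0 by apply: contra_neq q0 => g0; rewrite qE g0 mul0r.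
  have [|rs grs] := IH g g0.
    by move: qm; rewrite qE size_Mmonic ?monicXsubC // size_XsubC addn2.
  exists (t :: rs) => s; rewrite qE rootM root_XsubC inE => /orP [/grs ->|->] //.
  by rewrite orbT.
exists [seq t <- undup rs | `[< S t >] & root q t].
  by rewrite filter_uniq ?undup_uniq.
move=> t; rewrite mem_filter mem_undup; split.
  by move=> /andP[/andP[/asboolP ? ?] _].
by move=> [St qt]; rewrite qrs // qt andbT andbT; exact/asboolP.
Qed.

Definition lagrange_poly r (x : 'I_r -> R) (j : 'I_r) : {poly R} :=
  \prod_(i < r | i != j) ((x j - x i)^-1 *: ('X - (x i)%:P)).

Lemma lagrange_polyE r (x : 'I_r -> R) (i j : 'I_r) : injective x ->
  (lagrange_poly x j).[x i] = (i == j)%:R.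
Proof.
move=> x_inj; rewrite horner_prod; have [->|ij] := eqVneq i j.
  rewrite big1 // => k kj; rewrite hornerZ hornerXsubC mulVf //.
  by rewrite subr_eq0; apply: contra_neq kj => /x_inj.
by rewrite (bigD1 i) //= hornerZ hornerXsubC subrr mulr0 mul0r.
Qed.

Lemma size_lagrange_poly r (x : 'I_r -> R) j : (size (lagrange_poly x j) <= r)%N.
Proof.
apply: leq_trans (size_poly_prod_leq _ _) _.
have : (\sum_(i < r | i != j) size ((x j - x i)^-1 *: ('X - (x i)%:P))
    <= #|[pred i | i != j]| * 2)%N.
  rewrite -sum_nat_const; apply: leq_sum => i _.
  by rewrite (leq_trans (size_scale_leq _ _)) // size_XsubC.
have : #|[pred i | i != j]| = r.-1 by rewrite cardC1 card_ord.
have := ltn_ord j.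
set s := (\sum_(i < r | _) _)%N; set c := #|_| => r0 cE sc.
rewrite leq_subLR; move: r0 sc; rewrite cE; lia.
Qed.

(* The last hypothesis says that L is carried by the roots in S of any nonzero
   q >= 0 on S with L q <= 0. *)
Lemma moment_representation (S : set R) (n : nat) (L : {poly R} -> R) :
  linear_for *%R L -> L 1 = 1 -> (0 < n)%N ->
  (forall q f : {poly R}, q != 0 -> (size q <= n.+1)%N -> (size f <= n.+1)%N ->
     (forall t, S t -> 0 <= q.[t]) -> L q <= 0 ->
     (forall t, S t -> root q t -> 0 <= f.[t]) -> 0 <= L f) ->
  convex_hull [set \row_(k < n.+1) t ^+ k | t in S] (\row_(k < n.+1) L 'X^k).
Proof.
move=> Llin L1; case: n => // n _ faceP; apply: contrapT => notin.
(* The coordinate of index 0 is 1 on the curve and at the target, so it is dropped. The others are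
   centred at the target: 0 in the hull of the [m t] would put the target in the hull of the
   curve. *)
pose m (t : R) : 'rV[R]_n.+1 := \row_(k < n.+1) (t ^+ k.+1 - L 'X^(k.+1)).
have [|c c0 cm] := @weak_separation R n [set m t | t in S].
  move=> [k [w [v [w0 w1 vS vE]]]]; apply: notin.
  have /choice [t tP] : forall i, exists t, S t /\ m t = v i.
    by move=> i; have [t St tE] := vS i; exists t.
  exists k, w, (fun i => \row_(k < n.+2) t i ^+ k); split => //.
    by move=> i; exists (t i) => //; have [] := tP i.
  apply/rowP => j; rewrite mxE summxE.
  rewrite (eq_bigr (fun i => w i * t i ^+ j)); last by move=> i _; rewrite !mxE.
  case: (unliftP ord0 j) => [j' ->|->]; last first.
    by rewrite expr0 L1 -[LHS]w1; apply: eq_bigr => i _; rewrite expr0 mulr1.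
  have /rowP /(_ j') := vE; rewrite mxE summxE => vEj; apply/eqP.
  rewrite -subr_eq0 -oppr_eq0 opprB; apply/eqP; rewrite [RHS]vEj.
  rewrite -[L _]mul1r -w1 mulr_suml -sumrB; apply: eq_bigr => i _.
  by rewrite mxE -(tP i).2 mxE lift0 mulrBr.
(* The separating normal read as a polynomial: its value at [t] is the pairing of [c] with [m t],
   and centring together with [L 1 = 1] gives [L q = 0]. *)
pose q : {poly R} := \sum_(k < n.+1) c 0 k *: ('X^(k.+1) - (L 'X^(k.+1))%:P).
have qt t : q.[t] = (c *m (m t)^T) 0 0.
  rewrite horner_sum mxE; apply: eq_bigr => k _.
  by rewrite !mxE hornerZ hornerD hornerN hornerXn hornerC.
have Lq : L q = 0.
  rewrite functional_sum // big1 // => k _.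
  by rewrite functionalZ // functionalB // functionalC // L1 mulr1 subrr mulr0.
have szq : (size q <= n.+2)%N.
  apply: leq_trans (size_sum _ _ _) _; apply/bigmax_leqP => k _.
  apply: leq_trans (size_scale_leq _ _) _; apply: leq_trans (size_polyD _ _) _; rewrite size_polyN.
  rewrite geq_max size_polyXn ltnS ltn_ord /=.
  exact: leq_trans (size_polyC_leq1 _) _.
(* The coefficient of ['X^(k.+1)] in [q] is [c 0 k]; dropping the constant coordinate is what makes
   [q] nonzero along with [c]. *)
have q0 : q != 0.
  have /rV0Pn [k ck] := c0; apply: contra_neq ck => /polyP /(_ k.+1).
  rewrite coef0 coef_sum (bigD1 k) //= big1 ?addr0 => [|i ik].
    by rewrite coefZ coefB coefXn coefC eqxx subr0 mulr1.
  rewrite coefZ coefB coefXn coefC /= eqSS subr0.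
  by rewrite (negbTE (_ : k != i :> nat)) ?mulr0 // eq_sym.
have q_ge0 t : S t -> 0 <= q.[t] by move=> St; rewrite qt; apply: cm; exists t.
have [rs rs_uniq rsP] := roots_in_set S q0.
have rs_size : (size rs <= n.+1)%N.
  rewrite -ltnS (leq_trans _ szq) // max_poly_roots //.
  by apply/allP => t /rsP [].
pose x (i : 'I_(size rs)) := nth 0 rs i.
have xP i : S (x i) /\ root q (x i) by apply/rsP; rewrite mem_nth.
have x_inj : injective x.
  by move=> i j /eqP; rewrite nth_uniq // => /eqP /val_inj.
pose l := lagrange_poly x.
have Lface (f : {poly R}) : (size f <= n.+2)%N -> (forall i, 0 <= f.[x i]) -> 0 <= L f.
  move=> szf f0; apply: (faceP q) => //; first by rewrite Lq.
  move=> t St qt0; have /(nthP 0) [i ilt <-] : t \in rs by exact/rsP.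
  exact: (f0 (Ordinal ilt)).
have szl i : (size (l i) <= n.+2)%N.
  by rewrite (leq_trans (size_lagrange_poly _ _)) // (leq_trans rs_size).
(* ['X^k] minus its interpolant vanishes at every node, so [Lface] applies to it and to its opposite
   and [L] kills it. The bound on the number of roots keeps the interpolant within the admissible
   degree. *)
have LX (k : nat) : (k < n.+2)%N -> L 'X^k = \sum_i L (l i) * x i ^+ k.
  move=> kn; pose f : {poly R} := 'X^k - \sum_i x i ^+ k *: l i.
  have f0 i : f.[x i] = 0.
    rewrite hornerD hornerN hornerXn horner_sum (bigD1 i) //= big1 => [|j ji].
      by rewrite hornerZ lagrange_polyE // eqxx mulr1 addr0 subrr.
    by rewrite hornerZ lagrange_polyE // eq_sym (negbTE ji) mulr0.
  have szf : (size f <= n.+2)%N.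
    rewrite (leq_trans (size_polyD _ _)) // geq_max size_polyXn kn size_polyN.
    rewrite (leq_trans (size_sum _ _ _)) //; apply/bigmax_leqP => i _.
    exact: leq_trans (size_scale_leq _ _) _.
  have /eqP : L f = 0.
    apply/eqP; rewrite eq_le Lface ?andbT // => [|i]; last by rewrite f0.
    rewrite -oppr_ge0 -functionalN // Lface ?size_polyN // => i.
    by rewrite hornerN f0 oppr0.
  rewrite functionalB // functional_sum // subr_eq0 => /eqP ->.
  by apply: eq_bigr => i _; rewrite functionalZ // mulrC.
apply: notin; exists (size rs), (fun i => L (l i)), (fun i => \row_k x i ^+ k).
split.
- by move=> i; apply: Lface => // j; rewrite lagrange_polyE // ler0n.
- by rewrite -L1 -(expr0 'X) LX //; apply: eq_bigr => i _; rewrite mulr1.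
- by move=> i; exists (x i) => //; have [] := xP i.
- apply/rowP => k; rewrite mxE summxE LX //.
  by apply: eq_bigr => i _; rewrite !mxE.
Qed.

End Representation.

(** * Positive polynomials on a segment *)

Section Positivity.
Variable R : realType.
Implicit Types (a b t : R) (f g h s : {poly R}) (L : {poly R} -> R).

(** By continuity a negative value at [t0] would persist at nearby points of the segment. This
    recovers the sign of a quotient at the root that was divided out. *)
Lemma horner_ge0_punctured a b t0 h : a < b -> a <= t0 <= b ->
  (forall t, a <= t <= b -> t != t0 -> 0 <= h.[t]) ->
  forall t, a <= t <= b -> 0 <= h.[t].
Proof.
move=> ab /andP[at0 t0b] h0 t tab; have [->|] := eqVneq t t0; last exact: h0.
rewrite leNgt; apply/negP => ht0.
have : \forall u \near t0, h.[u] < 0.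
  exact: (@continuous_horner R h t0 _ (lt_nbhsl ht0)).
move=> /nbhs_ballP [e /= e0 eh].
have [u uab [ut0 ue]] : exists2 u, a <= u <= b & u != t0 /\ ball t0 e u.
  (* The nearby point is taken to the right of [t0], or to the left when [t0] is the right
     endpoint. *)
  have [t0ltb|blet0] := ltP t0 b.
    pose d := Num.min (e / 2) (b - t0).
    have d0 : 0 < d by rewrite lt_min subr_gt0 t0ltb divr_gt0.
    have de : d <= e / 2 by rewrite ge_min lexx.
    have db : d <= b - t0 by rewrite ge_min lexx orbT.
    exists (t0 + d); first by apply/andP; split; lra.
    split; first by rewrite gt_eqF ?ltrDl.
    rewrite -ball_normE /= opprD addrA subrr add0r normrN gtr0_norm // //.
    rewrite (le_lt_trans de) //.
    by rewrite ltr_pdivrMr // ltr_pMr // ltr1n.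
  pose d := Num.min (e / 2) (t0 - a).
  have d0 : 0 < d by rewrite lt_min subr_gt0 (lt_le_trans ab blet0) divr_gt0.
  have de : d <= e / 2 by rewrite ge_min lexx.
  have da : d <= t0 - a by rewrite ge_min lexx orbT.
  exists (t0 - d); first by apply/andP; split; lra.
  split; first by rewrite lt_eqF // ltrBlDr ltrDl.
  rewrite -ball_normE /= opprB addrCA subrr addr0 gtr0_norm //.
  rewrite (le_lt_trans de) //.
  by rewrite ltr_pdivrMr // ltr_pMr // ltr1n.
by have := h0 u uab ut0; rewrite leNgt (eh u ue).
Qed.

Lemma linear_for_mul L g : linear_for *%R L -> linear_for *%R (fun f => L (g * f)).
Proof. by move=> Llin c f h /=; rewrite mulrDr -scalerAr Llin. Qed.

(* The products (X - a)^i (b - X)^j s^2 of degree at most n, of either parity, so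
   that the condition passes to f |-> L ((X - a) f) with n - 1 in place of n. *)
Definition interval_psd n a b L := forall i j s,
  (i + j + 2 * (size s).-1 <= n)%N ->
  0 <= L (('X - a%:P) ^+ i * (b%:P - 'X) ^+ j * s ^+ 2).

(* Lukacs: f minus its minimum vanishes at some t0 in [a, b], to even order if
   t0 is interior, so dividing by X - a, b - X or (X - t0)^2 lowers the degree. *)
Lemma interval_psd_ge0 a b n L f : a < b -> linear_for *%R L ->
  interval_psd n a b L -> (size f <= n.+1)%N ->
  (forall t, a <= t <= b -> 0 <= f.[t]) -> 0 <= L f.
Proof.
move=> ab; elim/ltn_ind: n L f => n IH L f Llin Lpos szf f0.
have [t0] := EVT_min (ltW ab) (continuous_subspaceT (@continuous_horner R f)).
rewrite in_itv /= => t0ab tmin; set c := f.[t0] in tmin.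
have c0 : 0 <= c by exact: f0.
pose g := f - c%:P.
have g0 t : a <= t <= b -> 0 <= g.[t].
  by move=> tab; rewrite hornerD hornerN hornerC subr_ge0 tmin // in_itv.
have gt0 : root g t0 by rewrite /root hornerD hornerN hornerC subrr.
have L1 : 0 <= L 1.
  by have := Lpos 0%N 0%N 1; rewrite !expr0 !mul1r expr1n size_poly1; apply.
suff Lg : 0 <= L g.
  by rewrite -(subrK c%:P f) functionalD // functionalC // addr_ge0 ?mulr_ge0.
have szg : (size g <= n.+1)%N.
  rewrite (leq_trans (size_polyD _ _)) // geq_max szf size_polyN.
  exact: leq_trans (size_polyC_leq1 _) _.
have [->|gn0] := eqVneq g 0; first by rewrite functional0.
have /factor_theorem [h gE] := gt0.
have hn0 : h != 0 by apply: contra_neq gn0 => h0; rewrite gE h0 mul0r.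
have szh : (0 < size h < n.+1)%N.
  move: szg; rewrite gE size_Mmonic ?monicXsubC // size_XsubC addn2 /=.
  by rewrite size_poly_gt0 hn0.
have gtE t : g.[t] = h.[t] * (t - t0) by rewrite gE hornerM hornerXsubC.
have npos : (0 < n)%N by move: szh; clear; lia.
have n0 : (n.-1 < n)%N by move: szh; clear; lia.
have [t0a|t0a] := eqVneq t0 a.
  rewrite gE mulrC; apply: (IH n.-1 n0 (fun f => L (('X - t0%:P) * f))).
  - exact: linear_for_mul.
  - move=> i j s ijs; rewrite t0a 2!(mulrA ('X - a%:P)) -exprS; apply: Lpos.
    by move: ijs szh; clear; lia.
  - by rewrite prednK //; case/andP: szh.
  apply: (horner_ge0_punctured ab t0ab) => t tab tt0.
  have := g0 t tab; rewrite gtE pmulr_lge0 // subr_gt0 lt_def tt0 t0a.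
  by case/andP: tab.
have [t0b|t0b] := eqVneq t0 b.
  have -> : g = (b%:P - 'X) * (- h) by rewrite gE t0b mulrN mulrC -mulNr opprB.
  apply: (IH n.-1 n0 (fun f => L ((b%:P - 'X) * f))).
  - exact: linear_for_mul.
  - move=> i j s ijs.
    rewrite [X in L X](_ : _ = ('X - a%:P) ^+ i * (b%:P - 'X) ^+ j.+1 * s ^+ 2).
      by apply: Lpos; move: ijs szh; clear; lia.
    rewrite (exprS _ j); move: (_ ^+ i) (_ ^+ j) => u v; ring.
  - by rewrite prednK // size_polyN; case/andP: szh.
  apply: (horner_ge0_punctured ab t0ab) => t tab tt0.
  have := g0 t tab; rewrite gtE hornerN oppr_ge0 nmulr_lge0 // subr_lt0 lt_def.
  by rewrite eq_sym tt0 t0b; case/andP: tab.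
have [at0 lt0b] : a < t0 /\ t0 < b.
  by case/andP: t0ab => ? ?; rewrite !lt_def t0a eq_sym t0b.
(* Since [g] is nonnegative on both sides of the interior point [t0], its quotient [h] by
   ['X - t0%:P] is nonpositive on the left and nonnegative on the right, hence zero at [t0]. *)
have ht0 : root h t0.
  apply/eqP/le_anti/andP; split.
    rewrite -oppr_ge0 -hornerN.
    have at0' : a <= t0 <= t0 by rewrite (ltW at0) lexx.
    apply: (horner_ge0_punctured at0 at0') => // t /andP[at_ tt0] tnt0.
    have := g0 t; rewrite at_ (le_trans tt0 (ltW lt0b)) => /(_ isT).
    by rewrite gtE hornerN oppr_ge0 nmulr_lge0 // subr_lt0 lt_neqAle tnt0.
  have tt0b' : t0 <= t0 <= b by rewrite (ltW lt0b) lexx.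
  apply: (horner_ge0_punctured lt0b tt0b') => // t /andP[tt0 tb] tnt0.
  have := g0 t; rewrite tb (le_trans (ltW at0) tt0) => /(_ isT).
  by rewrite gtE pmulr_lge0 // subr_gt0 lt_def tnt0.
have /factor_theorem [k hE] := ht0.
have kn0 : k != 0 by apply: contra_neq hn0 => k0; rewrite hE k0 mul0r.
have szk : (0 < size k < n)%N.
  case/andP: szh => _; rewrite hE size_Mmonic ?monicXsubC // size_XsubC addn2 /=.
  by rewrite size_poly_gt0 kn0 ltnS.
have n2 : (n.-2 < n)%N by move: szk; clear; lia.
have -> : g = ('X - t0%:P) ^+ 2 * k by rewrite gE hE; ring.
apply: (IH n.-2 n2 (fun f => L (('X - t0%:P) ^+ 2 * f))).
- exact: linear_for_mul.
- move=> i j s ijs.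
  (* The new factor is a square and is absorbed into [s], whose degree grows by one while the bound
     drops by two. *)
  rewrite mulrCA -exprMn; apply: Lpos.
  have : (size (('X - t0%:P) * s)%R <= (size s).+1)%N.
    by rewrite (leq_trans (size_polyMleq _ _)) // size_XsubC.
  move: ijs szk; move: (size (_ * s)) (size s) (size k) => ? ? ?; clear; lia.
- case/andP: szk => _; move: (size k) n2 => ?; clear; lia.
apply: (horner_ge0_punctured ab t0ab) => t tab tt0.
have := g0 t tab; rewrite gtE hE hornerM hornerXsubC -mulrA -expr2 pmulr_lge0 //.
by rewrite exprn_even_gt0 // subr_eq0.
Qed.

(* Multiplication by 1 = ((X - a) + (b - X)) / (b - a) adjusts the parity. *)
Lemma interval_psd_reduced n a b L : a < b -> linear_for *%R L ->
  (forall (i j : bool) s, odd (i + j) = odd n ->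
     (i + j + 2 * (size s).-1 <= n)%N ->
     0 <= L (('X - a%:P) ^+ i * (b%:P - 'X) ^+ j * s ^+ 2)) ->
  interval_psd n a b L.
Proof.
move=> ab Llin H.
(* Even powers of the two linear factors move into the square, which leaves the exponents [odd i]
   and [odd j]. *)
have parity i j s : odd (i + j) = odd n -> (i + j + 2 * (size s).-1 <= n)%N ->
    0 <= L (('X - a%:P) ^+ i * (b%:P - 'X) ^+ j * s ^+ 2).
  move=> ijn szs.
  have := H (odd i) (odd j) (('X - a%:P) ^+ i./2 * (b%:P - 'X) ^+ j./2 * s).
  have -> : ('X - a%:P) ^+ odd i * (b%:P - 'X) ^+ odd j *
      (('X - a%:P) ^+ i./2 * (b%:P - 'X) ^+ j./2 * s) ^+ 2 =
      ('X - a%:P) ^+ i * (b%:P - 'X) ^+ j * s ^+ 2.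
    rewrite -[in RHS](odd_double_half i) -[in RHS](odd_double_half j).
    rewrite !exprD -!muln2 !exprM; ring.
  apply; first by rewrite oddD !oddb -oddD.
  have szX : size ('X - a%:P) = 2%N by rewrite size_XsubC.
  have szb : size (b%:P - 'X) = 2%N by rewrite -opprB size_polyN size_XsubC.
  set u := ('X - a%:P) ^+ i./2; set v := (b%:P - 'X) ^+ j./2.
  have : (size u <= i./2.+1)%N.
    by rewrite (leq_trans (size_poly_exp_leq _ _)) // szX mul1n.
  have : (size v <= j./2.+1)%N.
    by rewrite (leq_trans (size_poly_exp_leq _ _)) // szb mul1n.
  have := size_polyMleq u v; have := size_polyMleq (u * v) s.
  have := odd_double_half i; have := odd_double_half j; move: szs.
  rewrite -!muln2; move: (size (u * v * s)) (size (u * v)) (size u) (size v) (size s).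
  move: (i./2) (j./2) (nat_of_bool (odd i)) (nat_of_bool (odd j)) => *. lia.
move=> i j s szs.
have [par|npar] := eqVneq (odd (i + j)) (odd n); first exact: parity.
set g := _ * _ ^+ 2.
have nodd : odd (i + j).+1 = odd n by move: npar => /=; case: odd; case: odd.
(* With the wrong parity the degree bound cannot be an equality, so there is room for one more
   linear factor. *)
have ltn_ : ((i + j).+1 + 2 * (size s).-1 <= n)%N.
  move: szs nodd; rewrite leq_eqVlt => /orP[/eqP <-|//].
  by rewrite oddD mul2n odd_double addbF /=; case: odd.
have : 0 <= L (('X - a%:P) * g + (b%:P - 'X) * g).
  rewrite functionalD // /g addr_ge0 //.
    by rewrite 2!(mulrA ('X - a%:P)) -exprS; apply: parity.
  rewrite [X in L X](_ : _ = ('X - a%:P) ^+ i * (b%:P - 'X) ^+ j.+1 * s ^+ 2).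
    by apply: parity; rewrite addnS.
  rewrite /g (exprS _ j); move: (_ ^+ i) (_ ^+ j) => u v; ring.
rewrite -mulrDl (_ : 'X - a%:P + (b%:P - 'X) = (b - a)%:P).
  by rewrite mul_polyC functionalZ // pmulr_rge0 // subr_gt0.
by rewrite polyCB; ring.
Qed.

End Positivity.

(** * Hankel matrices and moment functionals *)

Section MomentFunctional.
Variables (R : realType).
Implicit Types (u : nat -> R) (f g s q : {poly R}) (L : {poly R} -> R).

Definition moment_functional u f : R := \sum_(i < size f) f`_i * u i.

Lemma moment_functionalE u f N : (size f <= N)%N ->
  moment_functional u f = \sum_(i < N) f`_i * u i.
Proof.
move=> szf; rewrite /moment_functional (big_ord_widen N (fun i => f`_i * u i)) //.
rewrite [LHS]big_mkcond; apply: eq_bigr => i _; case: ltnP => // szi.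
by rewrite nth_default // mul0r.
Qed.

Lemma moment_functional_linear u : linear_for *%R (moment_functional u).
Proof.
move=> c f g; pose N := maxn (size f) (size g).
have szf : (size f <= N)%N by exact: leq_maxl.
have szg : (size g <= N)%N by exact: leq_maxr.
have szfg : (size (c *: f + g)%R <= N)%N.
  rewrite (leq_trans (size_polyD _ _)) // geq_max szg andbT.
  exact: leq_trans (size_scale_leq _ _) _.
rewrite !(@moment_functionalE _ _ N) // mulr_sumr -big_split /=.
by apply: eq_bigr => i _; rewrite coefD coefZ mulrDl mulrA.
Qed.

Lemma moment_functionalXn u k : moment_functional u 'X^k = u k.
Proof.
rewrite (@moment_functionalE _ _ k.+1) ?size_polyXn // (bigD1 ord_max) //=.
rewrite coefXn eqxx mul1r big1 ?addr0 // => i ik.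
by rewrite coefXn (_ : (i == k :> nat) = false) ?mul0r //; exact: negbTE.
Qed.

(** The quadratic form of the Hankel matrix of [L] localized by the weight [g], at the coefficient
    vector of [s], is the expansion of [L (g * s ^+ 2)]. *)
Lemma hankel_form L g N (s : {poly R}) : linear_for *%R L -> (size s <= N)%N ->
  let x : 'rV[R]_N := \row_i s`_i in
  (x *m (\matrix_(i, j) L (g * 'X^(i + j))) *m x^T) 0 0 = L (g * s ^+ 2).
Proof.
move=> Llin szs x.
have sE : s = \sum_(i < N) s`_i *: 'X^i.
  rewrite -[LHS]coefK poly_def (big_ord_widen N (fun i => s`_i *: 'X^i)) //.
  rewrite [LHS]big_mkcond; apply: eq_bigr => i _; case: ltnP => // szi.
  by rewrite nth_default // scale0r.
rewrite [in RHS]sE expr2 mulr_suml mulr_sumr functional_sum // mxE.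
under eq_bigr do rewrite mxE mulr_suml.
apply: eq_bigr => i _ /=.
rewrite mulr_sumr mulr_sumr functional_sum //; apply: eq_bigr => j _; rewrite !mxE.
have -> : g * (s`_i *: 'X^i * (s`_j *: 'X^j)) = (s`_i * s`_j) *: (g * 'X^(j + i)).
  by rewrite -!mul_polyC polyCM exprD; ring.
by rewrite functionalZ // mulrAC [s`_i * _]mulrC.
Qed.

Lemma psd_hankelP L g N : linear_for *%R L ->
  psd (\matrix_(i < N, j < N) L (g * 'X^(i + j))) <->
  (forall s, (size s <= N)%N -> 0 <= L (g * s ^+ 2)).
Proof.
move=> Llin; split => [[_ psdA] s szs|Lge0].
  by rewrite -(hankel_form g Llin szs).
split=> [|x]; first by apply/matrixP => i j; rewrite !mxE addnC.
have := hankel_form g Llin (size_poly N (fun k => (rVpoly x)`_k)).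
have -> : (\row_i (\poly_(k < N) (rVpoly x)`_k)`_i) = x :> 'rV_N.
  by apply/rowP => i; rewrite mxE coef_poly ltn_ord coef_rVpoly_ord.
by move=> ->; apply/Lge0/size_poly.
Qed.

(** The matrices of the theorem are localized Hankel matrices whose weights are nonnegative on
    [[eps, 1 - eps]]. For even [n], the term [eps * (1 - eps)] of [matB] is the constant of the
    product of ['X - eps%:P] and [(1 - eps)%:P - 'X]. *)
Lemma matAE n u eps : matA n u eps = \matrix_(i, j) moment_functional u
  ((if odd n then 'X - eps%:P else 1) * 'X^(i + j)).
Proof.
have Llin := moment_functional_linear u.
rewrite /matA; case: ifP => _; apply/matrixP => i j; rewrite !mxE.
  rewrite [X in moment_functional u X]mulrBl -exprS mul_polyC functionalB //.
  by rewrite functionalZ // !moment_functionalXn.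
by rewrite mul1r moment_functionalXn.
Qed.

Lemma matBE n u eps : matB n u eps = \matrix_(i, j) moment_functional u
  ((if odd n then (1 - eps)%:P - 'X else ('X - eps%:P) * ((1 - eps)%:P - 'X))
   * 'X^(i + j)).
Proof.
have Llin := moment_functional_linear u.
rewrite /matB; case: ifP => _; apply/matrixP => i j; rewrite !mxE.
  rewrite [X in moment_functional u X]mulrBl -exprS mul_polyC functionalB //.
  by rewrite functionalZ // !moment_functionalXn.
have -> : ('X - eps%:P) * ((1 - eps)%:P - 'X) =
    'X - 'X^2 - (eps * (1 - eps))%:P :> {poly R}.
  by rewrite polyCM polyCB; ring.
rewrite 2!(mulrBl 'X^(i + j)) -exprS -exprD mul_polyC !functionalB // functionalZ //.
by rewrite !moment_functionalXn.
Qed.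

(** The parity of [n] leaves two pairs of exponents in {0, 1}: (1,0) and (0,1) for odd [n], (0,0)
    and (1,1) for even [n]. They are the weights of [matA] and [matB], and the matrix sizes match
    the degree bounds. *)
Lemma psd_interval_psd n u eps : eps < 1 / 2 ->
  psd (matA n u eps) -> psd (matB n u eps) ->
  interval_psd n eps (1 - eps) (moment_functional u).
Proof.
move=> eps_lt; have Llin := moment_functional_linear u.
rewrite matAE matBE !psd_hankelP // => posA posB.
apply: interval_psd_reduced => //; first by lra.
move=> i j s par szs; have := odd_double_half n; rewrite -muln2 => nE.
move: posA posB; rewrite uphalf_half; move: par szs.
case: (odd n) nE => nE; case: i; case: j => //= _ szs posA posB.
- by rewrite expr1 expr0 mulr1; apply: posA; move: szs; rewrite -nE; lia.
- by rewrite expr1 expr0 mul1r; apply: posB; move: szs; rewrite -nE; lia.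
- by rewrite !expr1; apply: posB; move: szs; rewrite -nE; lia.
- by rewrite !expr0 mulr1; apply: posA; move: szs; rewrite -nE; lia.
Qed.

Lemma compact_face a b n L q f : a < b -> linear_for *%R L -> L 1 = 1 ->
  (forall h : {poly R}, (size h <= n.+1)%N ->
     (forall t, a <= t <= b -> 0 <= h.[t]) -> 0 <= L h) ->
  (size q <= n.+1)%N -> (size f <= n.+1)%N ->
  (forall t, a <= t <= b -> 0 <= q.[t]) -> L q <= 0 ->
  (forall t, a <= t <= b -> root q t -> 0 <= f.[t]) -> 0 <= L f.
Proof.
move=> ab Llin L1 Lpos szq szf q0 Lq fq.
suff H eta : 0 < eta -> - eta <= L f.
  rewrite leNgt; apply/negP => Lf.
  by have := H (- L f / 2); lra.
move=> eta0.
(* [g] adds to [q] twice the positive part of [f + eta]. It is positive on the segment, because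
   [f + eta] is positive at the roots of [q], and it equals [q] where [f + eta] is negative. *)
pose g t := q.[t] + (`|f.[t] + eta| + (f.[t] + eta)).
have cg : continuous g.
  have cf : continuous (fun t => f.[t] + eta).
    by move=> t; apply: cvgD; [exact: continuous_horner | exact: cvg_cst].
  move=> t; apply: cvgD; first exact: continuous_horner.
  by apply: cvgD; [apply: cvg_norm |]; exact: cf.
have [c] := EVT_min (ltW ab) (continuous_subspaceT cg).
rewrite in_itv /= => cab cmin.
have gc0 : 0 < g c.
  have abs0 : 0 <= `|f.[c] + eta| + (f.[c] + eta).
    by rewrite -[X in _ + X]opprK subr_ge0 -normrN ler_norm.
  have [qc0|qc0] := eqVneq q.[c] 0.
    have fc0 : 0 <= f.[c] by apply: fq => //; apply/rootP.
    by rewrite /g qc0 ger0_norm; lra.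
  have : 0 < q.[c] by rewrite lt_def qc0 q0.
  by rewrite /g; lra.
have [d] := EVT_min (ltW ab) (continuous_subspaceT (@continuous_horner R f)).
rewrite in_itv /= => dab dmin.
(* Where [f + eta] is negative, [q] is at least the minimum [g c], so [C * q] outweighs [f], whose
   minimum is [f.[d]]. *)
pose C := `|f.[d]| / g c.
have C0 : 0 <= C by rewrite divr_ge0 // ltW.
have : 0 <= L (C *: q + (f + eta%:P)).
  apply: Lpos.
    rewrite (leq_trans (size_polyD _ _)) // geq_max.
    rewrite (leq_trans (size_scale_leq _ _)) //.
    rewrite (leq_trans (size_polyD _ _)) // geq_max szf.
    exact: leq_trans (size_polyC_leq1 _) _.
  move=> t tab; rewrite !hornerD hornerC hornerZ.
  have Cq : 0 <= C * q.[t] by rewrite mulr_ge0 ?q0.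
  have [f0|f0] := leP 0 (f.[t] + eta); first by rewrite addr_ge0.
  have : g c <= g t by apply: cmin; rewrite in_itv.
  rewrite {2}/g ltr0_norm // addNr addr0 => gq.
  have : `|f.[d]| <= C * q.[t].
    by rewrite mulrAC ler_pdivlMr // ler_wpM2l.
  have : f.[d] <= f.[t] by apply: dmin; rewrite in_itv.
  have : - f.[d] <= `|f.[d]| by rewrite -normrN ler_norm.
  by lra.
rewrite !functionalD // functionalZ // functionalC // L1.
have : C * L q <= 0 by rewrite mulr_ge0_le0.
by lra.
Qed.

Lemma psd_moment_curve n u eps : (0 < n)%N -> u 0%N = 1 -> 0 < eps < 1 / 2 ->
  psd (matA n u eps) -> psd (matB n u eps) ->
  convex_hull [set \row_(k < n.+1) t ^+ k | t in [set t | eps <= t <= 1 - eps]]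
    (\row_(k < n.+1) u k).
Proof.
move=> n0 u0 /andP[eps0 eps_lt] psdA psdB.
have ab : eps < 1 - eps by lra.
have Llin := moment_functional_linear u.
have L1 : moment_functional u 1 = 1 by rewrite -(expr0 'X) moment_functionalXn.
have Lpos := interval_psd_ge0 ab Llin (psd_interval_psd eps_lt psdA psdB).
have -> : \row_(k < n.+1) u k = \row_(k < n.+1) moment_functional u 'X^k.
  by apply/rowP => k; rewrite !mxE moment_functionalXn.
apply: moment_representation => // q f _ szq szf q0 Lq fq.
exact: (compact_face ab Llin L1 Lpos szq szf q0 Lq fq).
Qed.

(** Up to degree [n] the functional is [f |-> \sum_i w i * f.[t i]], and the weights of both
    matrices are nonnegative at the atoms [t i]. *)
Lemma atomic_psd n u k (w t : 'I_k -> R) eps : (0 < n)%N ->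
  (forall i, 0 <= w i) -> (forall i, eps <= t i <= 1 - eps) ->
  (forall j, (j <= n)%N -> u j = \sum_i w i * t i ^+ j) ->
  psd (matA n u eps) /\ psd (matB n u eps).
Proof.
move=> n0 w0 teps uE; have Llin := moment_functional_linear u.
have LE f : (size f <= n.+1)%N -> moment_functional u f = \sum_i w i * f.[t i].
  move=> szf; rewrite (moment_functionalE _ szf).
  under eq_bigr => j _ do rewrite uE -1?ltnS // mulr_sumr.
  rewrite exchange_big; apply: eq_bigr => i _ /=.
  rewrite (horner_coef_wide _ szf) mulr_sumr; apply: eq_bigr => j _.
  by rewrite mulrCA.
have pos g s : (size (g * s ^+ 2)%R <= n.+1)%N -> (forall i, 0 <= g.[t i]) ->
    0 <= moment_functional u (g * s ^+ 2).
  move=> sz g0; rewrite LE // sumr_ge0 // => i _.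
  by rewrite mulr_ge0 // hornerM horner_exp mulr_ge0 // sqr_ge0.
have szX c : size ('X - c%:P : {poly R}) = 2%N by rewrite size_XsubC.
have szc c : size (c%:P - 'X : {poly R}) = 2%N.
  by rewrite -opprB size_polyN size_XsubC.
have te1 i : 0 <= t i - eps by rewrite subr_ge0; case/andP: (teps i).
have te2 i : 0 <= 1 - eps - t i by rewrite subr_ge0; case/andP: (teps i).
have size_mulsq g s : (size (g * s ^+ 2)%R <= size g + 2 * (size s).-1)%N.
  have := size_polyMleq g (s ^+ 2); have := size_polyMleq s s; rewrite -expr2.
  move: (size (g * _)) (size (s ^+ 2)) (size g) (size s); lia.
have nE := odd_double_half n; rewrite -muln2 in nE.
rewrite matAE matBE !psd_hankelP // uphalf_half; split=> s szs.
- apply: pos => [|i]; last by case: odd; rewrite ?hornerXsubC ?hornerC.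
  apply: leq_trans (size_mulsq _ _) _; move: nE szs.
  by case: odd => nE; rewrite ?szX ?size_poly1; move: (size s); lia.
- apply: pos => [|i]; last first.
    case: odd; rewrite ?hornerM ?hornerD ?hornerN ?hornerX ?hornerC //.
    by rewrite mulr_ge0.
  apply: leq_trans (size_mulsq _ _) _; move: nE szs.
  case: odd => nE; first by rewrite szc; move: (size s); lia.
  have := size_polyMleq ('X - eps%:P) ((1 - eps)%:P - 'X); rewrite szX szc.
  by move: (size _) (size s); lia.
Qed.

End MomentFunctional.

(** * Expectations *)

Lemma measurable_horner_comp d (T : measurableType d) (R : realType)
    (U : T -> R) (f : {poly R}) :
  measurable_fun setT U -> measurable_fun setT (fun w => f.[U w]).
Proof.
apply: measurableT_comp; apply: continuous_measurable_fun.
exact: continuous_horner.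
Qed.

Section Expectation.
Context d (T : measurableType d) (R : realType) (P : probability T R).
Variables (U : T -> R).
Hypotheses (mU : measurable_fun setT U) (U01 : forall w, 0 < U w < 1).
Implicit Types f q : {poly R}.

(** [fine] loses nothing: [U] stays in (0, 1), so [f.[U w]] is bounded by the sum of the absolute
    values of the coefficients. *)
Definition expect_poly f : R := fine ('E_P[fun w => f.[U w]])%E.

Lemma integrable_horner_comp f : P.-integrable setT (EFin \o (fun w => f.[U w])).
Proof.
apply: measurable_bounded_integrable => //; first exact: fin_num_fun_lty.
  exact: measurable_horner_comp.
exists (\sum_(i < size f) `|f`_i|); split; first exact: num_real.
move=> M /ltW fM w _ /=; apply: le_trans fM.
rewrite horner_coef (le_trans (ler_norm_sum _ _ _)) // ler_sum // => i _.
rewrite normrM normrX ler_piMr // exprn_ile1 //.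
by have /andP[U0 U1] := U01 w; rewrite gtr0_norm // ltW.
Qed.

Lemma expect_polyE f : ('E_P[fun w => f.[U w]] = (expect_poly f)%:E)%E.
Proof.
rewrite /expect_poly fineK // expectation_fin_num //.
exact/Lfun1_integrable/integrable_horner_comp.
Qed.

Lemma expect_poly_linear : linear_for *%R expect_poly.
Proof.
move=> a f g; apply: EFin_inj; rewrite EFinD EFinM -!expect_polyE.
have Lf h : (fun w => h.[U w]) \in Lfun P 1.
  exact/Lfun1_integrable/integrable_horner_comp.
rewrite -expectationZl // -expectationD //.
  by congr expectation; apply/funext => w /=; rewrite hornerD hornerZ mulrC.
apply/Lfun1_integrable; have := integrable_horner_comp (a *: f).
by congr (_.-integrable _ _); apply/funext => w /=; rewrite hornerZ mulrC.
Qed.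

Lemma expect_poly1 : expect_poly 1 = 1.
Proof.
apply: EFin_inj; rewrite -expect_polyE -(expectation_cst P 1).
by congr expectation; apply/funext => w; rewrite hornerC.
Qed.

(** A nonnegative variable of nonpositive mean vanishes almost surely, so [U] almost surely hits a
    root of [q], where [f] is nonnegative. *)
Lemma expect_poly_face q f : (forall t, 0 < t < 1 -> 0 <= q.[t]) ->
  expect_poly q <= 0 -> (forall t, 0 < t < 1 -> root q t -> 0 <= f.[t]) ->
  0 <= expect_poly f.
Proof.
move=> q0 Eq fq.
pose F h : T -> \bar R := fun w => (h.[U w])%:E.
have mE h : measurable_fun setT (F h).
  exact/measurable_EFinP/measurable_horner_comp.
have aeq : ae_eq P setT (F q) (cst 0%E).
  apply/(ae_eq_integral_abs P measurableT (mE q)).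
  rewrite (eq_integral (F q)); last first.
    by move=> w _ /=; rewrite ger0_norm ?q0.
  have := expect_polyE q; rewrite unlock => ->.
  congr EFin; apply/le_anti; rewrite Eq /= -lee_fin -expect_polyE unlock.
  by apply: integral_ge0 => w _; rewrite lee_fin q0.
rewrite -lee_fin -expect_polyE unlock.
(* [f.[U w]] agrees almost everywhere with its absolute value, whose integral is nonnegative. *)
rewrite (ae_eq_integral (fun w => `|f.[U w]|%:E)) //.
- by apply: integral_ge0 => w _; rewrite lee_fin.
- exact: mE.
- apply/measurable_EFinP; apply: measurableT_comp => //.
  exact: measurable_horner_comp.
- case: aeq => N [mN N0 subN]; exists N; split => // w nw; apply: subN => /= qw.
  apply: nw => _; have [/rootP qw0] := qw I.
  by rewrite ger0_norm // fq.
Qed.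

Lemma expect_poly_moment_curve n : (0 < n)%N ->
  convex_hull (open_moment_curve R n) (\row_(k < n.+1) expect_poly 'X^k).
Proof.
move=> n0; apply: moment_representation => //.
- exact: expect_poly_linear.
- exact: expect_poly1.
- by move=> q f _ _ _; exact: expect_poly_face.
Qed.

End Expectation.

(* Redefining V on the null event where it leaves (0, 1). *)
Lemma random_variable_in01 d (T : measurableType d) (R : realType)
    (P : probability T R) (V : {RV P >-> R}) :
  P [set w | 0 < V w < 1] = 1%E ->
  exists U : T -> R, [/\ measurable_fun setT U, forall w, 0 < U w < 1 &
    forall f : {poly R}, ('E_P[fun w => f.[V w]] = 'E_P[fun w => f.[U w]])%E].
Proof.
move=> PV; pose U w := if 0 < V w < 1 then V w else 1 / 2.
have mV : measurable_fun setT V by exact: measurable_funPT.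
have m01 : measurable_fun setT (fun w => 0 < V w < 1).
  by apply: measurable_and; apply: measurable_fun_ltr.
have mU : measurable_fun setT U by apply: measurable_fun_ifT.
exists U; split=> // [w|f].
  by rewrite /U; case: ifP => // _; apply/andP; split; lra.
have mf (W : T -> R) : measurable_fun setT W ->
    measurable_fun setT (fun w => (f.[W w])%:E).
  by move=> mW; apply/measurable_EFinP/measurable_horner_comp.
rewrite unlock; apply: ae_eq_integral => //; [exact: mf|exact: mf|].
have mD : measurable [set w | 0 < V w < 1].
  by have := m01 measurableT [set true] I; rewrite setTI.
exists (~` [set w | 0 < V w < 1]); split.
- exact: measurableC.
- by have := probability_setC P mD; rewrite PV subee.
- move=> w /= nVU Vw; apply: nVU => _; by rewrite /U Vw.
Qed.

(** * Discrete random variables and binomial moments *)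

Section FiniteProbability.
Local Open Scope ereal_scope.

Lemma finite_random_variable (R : realType) k (w t : 'I_k -> R) :
  (forall i, 0 <= w i)%R -> (\sum_i w i = 1)%R -> (forall i, 0 < t i < 1)%R ->
  exists (P : probability nat R) (V : {RV P >-> R}),
    (forall x, 0 < V x < 1)%R /\
    forall f : R -> R, (forall s, 0 < s < 1 -> 0 <= f s)%R ->
      'E_P[fun x => f (V x)] = (\sum_i w i * f (t i))%R%:E.
Proof.
move=> w0 w1 t01.
pose wt (n : nat) : R := oapp w 0%R (insub n).
have wt0 n : (0 <= wt n)%R by rewrite /wt; case: insub => /=.
have wtE i : wt (nat_of_ord i) = w i by rewrite /wt valK.
(* The law is the sum of the [w i] times the Dirac masses at [i < k]. The default 1/2 keeps [V]
   inside (0, 1) at every other integer as well. *)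
pose V (n : nat) : R := oapp t (1 / 2)%R (insub n).
have VE i : V (nat_of_ord i) = t i by rewrite /V valK.
have V01 n : (0 < V n < 1)%R.
  by rewrite /V; case: insub => [i|] //=; apply/andP; split; lra.
pose m := msum (fun n => mscale (NngNum (wt0 n)) (\d_n : measure nat R)) k.
have mT : m setT = 1.
  rewrite /m /msum /mscale /= -[RHS]/(1%:E) -w1 -sumEFin.
  apply: eq_bigr => i _. rewrite -wtE -[RHS]mule1; congr (_ * _); exact: diracT.
pose P : probability nat R :=
  HB.pack m (Measure_isProbability.Build _ _ _ m mT).
have mV : measurable_fun setT (V : nat -> R) by [].
pose rV : {RV P >-> R} := HB.pack V (isMeasurableFun.Build _ _ _ _ _ mV).
exists P, rV; split => // f f0.
rewrite unlock /= ge0_integral_measure_sum //=; last first.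
  by move=> x _; rewrite lee_fin f0.
rewrite -sumEFin; apply: eq_bigr => i _.
rewrite ge0_integral_mscale //=; last by move=> x _; rewrite lee_fin f0.
by rewrite integral_dirac //= diracT mul1e wtE VE EFinM.
Qed.

End FiniteProbability.

Section BinomialMoments.
Variable R : realType.

Lemma trinomial_revision n j k : (k <= j <= n)%N ->
  ('C(n, j) * 'C(j, k) = 'C(n, k) * 'C(n - k, j - k))%N.
Proof.
move=> /andP[kj jn]; have kn := leq_trans kj jn.
have pos : (0 < k`! * (j - k)`! * (n - j)`!)%N by rewrite !muln_gt0 !fact_gt0.
apply/eqP; rewrite -(eqn_pmul2r pos); apply/eqP.
have e1 := bin_fact kj; have e2 := bin_fact jn; have e3 := bin_fact kn.
have := bin_fact (leq_sub2r k jn); rewrite subnBA // subnK // => e4.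
transitivity n`!.
  by rewrite -e2 -e1; nia.
by rewrite -e3 -e4; nia.
Qed.

(** Trinomial revision extracts ['C(n, k)], and the shift of [j] by [k] leaves a binomial expansion.
    A general ring allows [x = 'X] and [y = 1 - 'X]. *)
Lemma binomial_factorial_moment (A : comNzRingType) (x y : A) n k : (k <= n)%N ->
  \sum_(j < n.+1 | (k <= j)%N) (x ^+ j * y ^+ (n - j)) *+ 'C(n, j) *+ 'C(j, k) =
  x ^+ k * (y + x) ^+ (n - k) *+ 'C(n, k).
Proof.
move=> kn.
pose F j := (x ^+ j * y ^+ (n - j)) *+ 'C(n, j) *+ 'C(j, k).
transitivity (\sum_(k <= j < n.+1) F j).
  by rewrite (big_nat_widenl _ 0) // big_mkord.
rewrite -{1}(add0n k) big_addn subSn // big_mkord exprDn mulr_sumr -sumrMnl.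
apply: eq_bigr => i _; rewrite /F -mulrnA trinomial_revision; last first.
  by have := ltn_ord i; move: kn; clear; lia.
rewrite addnK mulnC mulrnA mulrnAr (addnC i k) exprD subnDA -mulrA.
by rewrite [y ^+ _ * _]mulrC.
Qed.

Definition bernstein n j : {poly R} := 'X^j * (1 - 'X) ^+ (n - j) *+ 'C(n, j).

Lemma bernsteinE n j t : (bernstein n j).[t] = binomial_pmf n t j.
Proof.
rewrite /bernstein hornerMn hornerM !horner_exp hornerD hornerN hornerX.
by rewrite hornerC.
Qed.

(** The sum over [j] of ['C(j, k)] times the Bernstein polynomials is ['C(n, k)] times ['X^k]. A
    mixture of binomial laws thus has as its [u] the moments of the mixing functional. *)
Lemma umoment_bernstein n (p : 'rV[R]_n.+1) (L : {poly R} -> R) :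
  linear_for *%R L -> (forall j : 'I_n.+1, L (bernstein n j) = p 0 j) ->
  forall k, (k <= n)%N -> umoment p k = L 'X^k.
Proof.
move=> Llin Lp k kn; rewrite /umoment.
have -> : \sum_(j < n.+1 | (k <= j)%N) 'C(j, k)%:R * p 0 j =
    L (\sum_(j < n.+1 | (k <= j)%N) bernstein n j *+ 'C(j, k)).
  rewrite functional_sum //; apply: eq_bigr => j _.
  by rewrite -Lp -[X in _ = L X]scaler_nat functionalZ.
rewrite binomial_factorial_moment // subrK expr1n mulr1 -[X in _ * L X]scaler_nat.
by rewrite functionalZ // mulKf // pnatr_eq0 -lt0n bin_gt0.
Qed.

(* The linear map p |-> u is triangular with nonzero diagonal. *)
Lemma umoment_inj n (p q : 'rV[R]_n.+1) :
  (forall k, (k <= n)%N -> umoment p k = umoment q k) -> p = q.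
Proof.
(* Entries are identified from [j = n] downwards: the moment of order [j] involves only indices at
   least [j]. *)
move=> pq; apply/rowP => j; have [m] := ubnP (n - j); elim: m j => // m IH j jm.
have jn : (j <= n)%N by rewrite -ltnS.
have := pq j jn; rewrite /umoment => /mulfI.
move=> /(_ _); rewrite invr_eq0 pnatr_eq0 -lt0n bin_gt0 jn => /(_ isT).
rewrite (bigD1 j) //= [RHS](bigD1 j) //= binn !mul1r.
under eq_bigr => i /andP[ji ij].
  rewrite IH; first over.
  have : (j < i)%N by rewrite ltn_neqAle ji andbT eq_sym.
  by have := ltn_ord i; move: jm; clear; lia.
by move=> /addIr.
Qed.

Lemma umoment0 n (p : 'rV[R]_n.+1) : umoment p 0 = \sum_j p 0 j.
Proof.
rewrite /umoment bin0 invr1 mul1r; apply: eq_bigr => j _.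
by rewrite bin0 mul1r.
Qed.

End BinomialMoments.

(** * Finite mixtures on a curve and the cycle of implications *)

Lemma convex_hull_curveP (R : numDomainType) (E : lmodType R) (T : Type) (c : T -> E)
    (S : set T) x :
  convex_hull [set c t | t in S] x <-> exists k (w : 'I_k -> R) (t : 'I_k -> T),
    [/\ forall i, 0 <= w i, \sum_i w i = 1, forall i, S (t i)
      & x = \sum_i w i *: c (t i)].
Proof.
split=> [[k [w [v [w0 w1 vS ->]]]]|[k [w [t [w0 w1 tS ->]]]]].
  have /choice [t tP] : forall i, exists t, S t /\ c t = v i.
    by move=> i; have [t St tE] := vS i; exists t.
  exists k, w, t; split => // [i|]; first by have [] := tP i.
  by apply: eq_bigr => i _; rewrite (tP i).2.
by exists k, w, (c \o t); split => // i; exists (t i).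
Qed.

Lemma separated_from_endpoints (R : realType) k (t : 'I_k -> R) :
  (forall i, 0 < t i < 1) ->
  exists2 eps : R, 0 < eps < 1 / 2 & forall i, eps <= t i <= 1 - eps.
Proof.
(* The initial value 1/4 keeps [eps] below 1/2 whatever the points are. *)
move=> t01; pose eps := \big[Num.min/(1 / 4 : R)]_i Num.min (t i) (1 - t i).
have epsle i : eps <= Num.min (t i) (1 - t i) by exact: bigmin_le.
exists eps => [|i].
  have : eps <= 1 / 4 by exact: bigmin_le_id.
  have : 0 < eps.
    apply/bigmin_gtP; split=> [|i _]; first by lra.
    by have /andP[? ?] := t01 i; rewrite lt_min subr_gt0; apply/andP.
  by move=> ? ?; apply/andP; split; lra.
have := epsle i; rewrite le_min => /andP[? ?]; apply/andP; split=> //.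
by lra.
Qed.

Theorem theorem4 (R : realType) (n : nat) (p : 'rV[R]_n.+1)
    (n_ge2 : (2 <= n)%N)
    (p_ge0 : forall j, 0 <= p 0 j)
    (p_sum1 : \sum_(j < n.+1) p 0 j = 1) :
  let u := umoment p in
  [<->
    (exists eps : R,
       [/\ 0 < eps < 1 / 2, psd (matA n u eps) & psd (matB n u eps)]);
    convex_hull (open_binomial_curve R n) p;
    (exists (d : measure_display) (T : measurableType d)
            (P : probability T R) (V : {RV P >-> R}),
       P [set w | 0 < V w < 1] = 1%E /\
       forall j : 'I_n.+1,
         'E_P[fun w => (binomial_pmf n (V w) j)%R]%E = (p 0 j)%:E);
    convex_hull (open_moment_curve R n) (\row_(k < n.+1) u k);
    (exists (d : measure_display) (T : measurableType d)
            (P : probability T R) (V : {RV P >-> R}),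
       P [set w | 0 < V w < 1] = 1%E /\
       forall k : 'I_n.+1, 'E_P[fun w => (V w ^+ k)%R]%E = (u k)%:E)].
Proof.
move=> u; have n0 : (0 < n)%N by exact: ltnW.
have u0 : u 0%N = 1 by rewrite /u umoment0.
tfae.
- move=> [eps [eps01 psdA psdB]].
  have := psd_moment_curve n0 u0 eps01 psdA psdB.
  move=> /convex_hull_curveP [k [w [t [w0 w1 teps uE]]]].
  apply/convex_hull_curveP; exists k, w, t; split=> // [i|].
    have /andP[? ?] := teps i; have /andP[? ?] := eps01.
    by apply/andP; split; lra.
  (* The atoms found for [u] serve for [p]: the binomial mixture with the same weights has the
     moments of [L], which are those of [u], and [p] is determined by [u]. *)
  apply: umoment_inj => l ln; pose L f := \sum_i w i * f.[t i].
  have Llin : linear_for *%R L.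
    move=> a f g; rewrite /L /= mulr_sumr -big_split; apply: eq_bigr => i _ /=.
    by rewrite hornerD hornerZ mulrDr mulrCA.
  rewrite [RHS](umoment_bernstein Llin) // => [|j]; last first.
    rewrite summxE; apply: eq_bigr => i _.
    by rewrite bernsteinE !mxE.
  have /rowP /(_ (Ordinal (ln : (l < n.+1)%N))) := uE.
  rewrite mxE /= -/(u l) summxE => ->.
  by apply: eq_bigr => i _; rewrite !mxE hornerXn.
- move=> /convex_hull_curveP [k [w [t [w0 w1 t01 pE]]]].
  have [P [V [V01 VE]]] := finite_random_variable w0 w1 t01.
  exists _, nat, P, V; split=> [|j].
    rewrite (_ : [set x | 0 < V x < 1] = setT) ?probability_setT //.
    by apply/seteqP; split=> x // _; exact: V01.
  rewrite (VE (fun s => binomial_pmf n s j)) => [|s /andP[s0 s1]].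
    by rewrite pE summxE; congr EFin; apply: eq_bigr => i _; rewrite !mxE.
  by apply: binomial_pmf_ge0; rewrite !ltW.
- move=> [d [T [P [V [PV EV]]]]].
  have [U [mU U01 VU]] := random_variable_in01 PV.
  have -> : \row_(k < n.+1) u k = \row_(k < n.+1) expect_poly P U 'X^k.
    apply/rowP => k; rewrite !mxE.
    apply: umoment_bernstein; last by rewrite -ltnS.
      exact: expect_poly_linear.
    move=> j; apply: EFin_inj; rewrite -expect_polyE // -VU -EV.
    by congr expectation; apply/funext => x; rewrite bernsteinE.
  exact: expect_poly_moment_curve.
- move=> /convex_hull_curveP [k [w [t [w0 w1 t01 uE]]]].
  have [P [V [V01 VE]]] := finite_random_variable w0 w1 t01.
  exists _, nat, P, V; split=> [|j].
    rewrite (_ : [set x | 0 < V x < 1] = setT) ?probability_setT //.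
    by apply/seteqP; split=> x // _; exact: V01.
  rewrite (VE (fun s => s ^+ j)) => [|s /andP[s0 s1]].
    have /rowP /(_ j) := uE; rewrite mxE summxE => ->.
    by congr EFin; apply: eq_bigr => i _; rewrite !mxE.
  by rewrite exprn_ge0 // ltW.
- move=> [d [T [P [V [PV EV]]]]].
  have [U [mU U01 VU]] := random_variable_in01 PV.
  have := expect_poly_moment_curve P mU U01 n0.
  have -> : \row_(k < n.+1) expect_poly P U 'X^k = \row_(k < n.+1) u k.
    apply/rowP => k; rewrite !mxE; apply: EFin_inj.
    rewrite -expect_polyE // -VU -EV.
    by congr expectation; apply/funext => x; rewrite hornerXn.
  move=> /convex_hull_curveP [k [w [t [w0 w1 t01 uE]]]].
  (* [V] itself may come arbitrarily close to 0 and 1; replacing it by finitely many atoms with the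
     same moments up to [n] is what yields a positive [eps]. *)
  have [eps eps01 teps] := separated_from_endpoints t01.
  have [|psdA psdB] := @atomic_psd R n u k w t eps n0 w0 teps; last by exists eps.
  move=> j jn; have /rowP /(_ (Ordinal (jn : (j < n.+1)%N))) := uE.
  rewrite mxE summxE /= => ->.
  by apply: eq_bigr => i _; rewrite !mxE.
Qed.
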